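(* Let $\mathbf{k}$ be a commutative ring with 1 and let $\Gamma$ be a finite digraph whose cycles are pairwise disjoint. Then the Leavitt path algebra $L_{\mathbf{k}}(\Gamma)$ is free as a $\mathbf{k}$-module with basis $$\mathcal{B}:=\{pq^* \mid p,q\in Path(\Gamma),\ tp=tq \text{ is a sink}\}\ \cup\ \{pC^nq^*\mid C \text{ is a cycle},\ p,q\in P_C,\ n\in\mathbb{Z}\},$$ where $C^0:=sC$ and $C^{-n}:=(C^* )^n$ for $n>0$.
   Context: A digraph $\Gamma=(V,E,s,t)$ has vertex set $V$, arrow set $E$, and source and target maps $s,t:E\to V$ (written $se$, $te$). It is finite if $V$ and $E$ are finite. A sink is a vertex $v$ with $s^{-1}(v)=\emptyset$. A path of length $n>0$ is a sequence $p=e_1\cdots e_n$ of arrows with $te_i=se_{i+1}$; $sp:=se_1$, $tp:=te_n$; a path of length 0 is a vertex $v$ with $sv=tv=v$. $Path(\Gamma)$ is the set of all paths. A cycle is a path $C=e_1\cdots e_n$ with $n>0$, $sC=tC$ and $se_i\neq se_j$ for $i\neq j$; cycles differing by a cyclic rotation $e_1e_2\cdots e_n\sim e_2\cdots e_ne_1$ are considered equivalent, and one representative (hence a base vertex $sC$) is fixed for each class. Cycles are pairwise disjoint if inequivalent cycles have no common vertex. For a cycle $C$, $P_C:=\{p\in Path(\Gamma)\mid tp=sC \text{ and } p\neq qC \text{ for every path } q\}$. The Leavitt path algebra $L_{\mathbf{k}}(\Gamma)$ is the $\mathbf{k}$-algebra generated by $V\sqcup E\sqcup E^*$, where $E^*=\{e^*: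 e\in E\}$ with $s(e^* )=te$, $t(e^* )=se$, subject to the relations: (V) $vw=\delta_{v,w}v$ for $v,w\in V$; (E) $(se)e=e=e(te)$ for $e\in E\sqcup E^*$; (CK1) $e^*f=\delta_{e,f}\,te$ for $e,f\in E$; (CK2) $v=\sum_{se=v}ee^*$ for all $v\in V$ with $0<|s^{-1}(v)|<\infty$. For a path $p=e_1\cdots e_n$, $p^*:=e_n^*\cdots e_1^*$, and $v^*:=v$ for a vertex $v$. *)

(* Defs.v *)
From HB Require Import structures.
From mathcomp Require Import all_boot all_order all_algebra.
From mathcomp Require Import boolp.
Set Implicit Arguments.
Unset Strict Implicit.
Unset Printing Implicit Defensive.
Import GRing.Theory.
Local Open Scope ring_scope.
Local Open Scope quotient_scope.

Record digraph := Digraph {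
  vertex : finType;
  arrow : finType;
  src : arrow -> vertex;
  tgt : arrow -> vertex }.

Section Paths.
Variable G : digraph.
Implicit Types (v : vertex G) (e f : arrow G).

Definition is_sink v : bool := [forall e : arrow G, src e != v].

Definition is_path v (s : seq (arrow G)) : bool :=
  if s is e :: s' then (src e == v) && path (fun e f => tgt e == src f) e s'
  else true.

(* A path is a pair (v, [:: e_1; ...; e_n]) where v is its source, so that    *)
(* the pairs (v, [::]) are the paths of length 0.                             *)
Record gpath := GPath {
  pval : vertex G * seq (arrow G);
  _ : is_path pval.1 pval.2 }.

HB.instance Definition _ := [isSub for pval].
HB.instance Definition _ := [Choice of gpath by <:].

Implicit Types (p q C D : gpath).

Definition psrc p : vertex G := (pval p).1.
Definition parrows p : seq (arrow G) := (pval p).2.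
Definition ptgt p : vertex G := last (psrc p) [seq tgt e | e <- parrows p].

Definition is_cycle C : bool :=
  [&& parrows C != [::], psrc C == ptgt C & uniq [seq src e | e <- parrows C]].

Definition cycle_equiv C D : Prop :=
  exists n : nat, parrows D = rot n (parrows C).

Definition cycle_vertices C : seq (vertex G) := [seq src e | e <- parrows C].

Definition cycles_pairwise_disjoint : Prop :=
  forall C D, is_cycle C -> is_cycle D -> ~ cycle_equiv C D ->
  forall v, ~ (v \in cycle_vertices C /\ v \in cycle_vertices D).

(* R is a choice of one cycle in each equivalence class, and thereby of a     *)
(* base vertex for each cycle.                                                *)
Definition cycle_representatives (R : {pred gpath}) : Prop :=
  (forall C, C \in R -> is_cycle C) /\
  (forall C, is_cycle C -> exists! D, D \in R /\ cycle_equiv C D).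

(* The set P_C; the product q C makes sense when q ends at the base of C. *)
Definition in_P C p : Prop :=
  ptgt p = psrc C /\
  forall q, ptgt q = psrc C -> pval p <> (psrc q, parrows q ++ parrows C).

End Paths.

(* The Leavitt path algebra is built as the associative k-algebra presented   *)
(* by the generators and relations: formal expressions in the generators are  *)
(* identified along the least congruence containing the algebra axioms and    *)
(* the defining relations. No unit is adjoined; as the digraph is finite, the *)
(* sum of its vertices is one.                                                *)
Section Presentation.
Variables (k : comPzRingType) (G : digraph).

Inductive lterm : Type :=
  | TVertex of vertex G
  | TArrow of arrow G
  | TGhost of arrow G
  | TZero
  | TOpp of lterm
  | TAdd of lterm & lterm
  | TMul of lterm & lterm
  | TScale of k & lterm.

Inductive lcong : lterm -> lterm -> Prop :=
  | lc_refl x : lcong x x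
  | lc_sym x y : lcong x y -> lcong y x
  | lc_trans x y z : lcong x y -> lcong y z -> lcong x z
  | lc_opp x x' : lcong x x' -> lcong (TOpp x) (TOpp x')
  | lc_add x x' y y' :
      lcong x x' -> lcong y y' -> lcong (TAdd x y) (TAdd x' y')
  | lc_mul x x' y y' :
      lcong x x' -> lcong y y' -> lcong (TMul x y) (TMul x' y')
  | lc_scale a x x' : lcong x x' -> lcong (TScale a x) (TScale a x')
  | lc_addA x y z : lcong (TAdd x (TAdd y z)) (TAdd (TAdd x y) z)
  | lc_addC x y : lcong (TAdd x y) (TAdd y x)
  | lc_add0 x : lcong (TAdd TZero x) x
  | lc_addN x : lcong (TAdd (TOpp x) x) TZero
  | lc_scaleA a b x : lcong (TScale a (TScale b x)) (TScale (a * b) x)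
  | lc_scale1 x : lcong (TScale 1 x) x
  | lc_scaleDr a x y :
      lcong (TScale a (TAdd x y)) (TAdd (TScale a x) (TScale a y))
  | lc_scaleDl a b x :
      lcong (TScale (a + b) x) (TAdd (TScale a x) (TScale b x))
  | lc_mulA x y z : lcong (TMul x (TMul y z)) (TMul (TMul x y) z)
  | lc_mulDl x y z : lcong (TMul (TAdd x y) z) (TAdd (TMul x z) (TMul y z))
  | lc_mulDr x y z : lcong (TMul x (TAdd y z)) (TAdd (TMul x y) (TMul x z))
  | lc_scaleAl a x y : lcong (TScale a (TMul x y)) (TMul (TScale a x) y)
  | lc_scaleAr a x y : lcong (TScale a (TMul x y)) (TMul x (TScale a y))
  | lc_V v w :
      lcong (TMul (TVertex v) (TVertex w)) (if v == w then TVertex v else TZero)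
  | lc_E_src e : lcong (TMul (TVertex (src e)) (TArrow e)) (TArrow e)
  | lc_E_tgt e : lcong (TMul (TArrow e) (TVertex (tgt e))) (TArrow e)
  | lc_E_src_ghost e : lcong (TMul (TVertex (tgt e)) (TGhost e)) (TGhost e)
  | lc_E_tgt_ghost e : lcong (TMul (TGhost e) (TVertex (src e))) (TGhost e)
  | lc_CK1 e f :
      lcong (TMul (TGhost e) (TArrow f))
            (if e == f then TVertex (tgt e) else TZero)
  | lc_CK2 v : ~~ is_sink v ->
      lcong (TVertex v)
            (\big[TAdd/TZero]_(e | src e == v) TMul (TArrow e) (TGhost e)).

HB.instance Definition _ := gen_eqMixin lterm.
HB.instance Definition _ := gen_choiceMixin lterm.

Definition lcongb (x y : lterm) : bool := `[< lcong x y >].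

Lemma lcongb_refl : reflexive lcongb.
Proof. by move=> x; apply/asboolP/lc_refl. Qed.

Lemma lcongb_sym : symmetric lcongb.
Proof. by move=> x y; apply/asboolP/asboolP; apply: lc_sym. Qed.

Lemma lcongb_trans : transitive lcongb.
Proof.
by move=> y x z /asboolP xy /asboolP yz; apply/asboolP; apply: lc_trans yz.
Qed.

Canonical lcong_equiv := EquivRel lcongb lcongb_refl lcongb_sym lcongb_trans.

Definition leavitt : Type := {eq_quot lcongb}.

HB.instance Definition _ := Choice.on leavitt.

Definition lclass (x : lterm) : leavitt := \pi_({eq_quot lcongb}) x.

Lemma lclassP (x y : lterm) : lclass x = lclass y <-> lcong x y.
Proof. by split=> [/eqmodP/asboolP|xy]; last exact/eqmodP/asboolP. Qed.

Lemma lclass_ind (P : leavitt -> Prop) :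
  (forall x, P (lclass x)) -> forall u, P u.
Proof. by move=> Pc u; rewrite -[u]reprK; apply: Pc. Qed.

Lemma repr_lclass x : lcong (repr (lclass x)) x.
Proof. by apply/lclassP; rewrite /lclass reprK. Qed.

Definition lopp (u : leavitt) := lclass (TOpp (repr u)).
Definition ladd (u v : leavitt) := lclass (TAdd (repr u) (repr v)).
Definition lmul (u v : leavitt) := lclass (TMul (repr u) (repr v)).
Definition lscale (a : k) (u : leavitt) := lclass (TScale a (repr u)).

Lemma lclassN x : lclass (TOpp x) = lopp (lclass x).
Proof. exact/lclassP/lc_opp/lc_sym/repr_lclass. Qed.

Lemma lclassD x y : lclass (TAdd x y) = ladd (lclass x) (lclass y).
Proof. by apply/lclassP; apply: lc_add; apply/lc_sym/repr_lclass. Qed.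

Lemma lclassM x y : lclass (TMul x y) = lmul (lclass x) (lclass y).
Proof. by apply/lclassP; apply: lc_mul; apply/lc_sym/repr_lclass. Qed.

Lemma lclassZ a x : lclass (TScale a x) = lscale a (lclass x).
Proof. exact/lclassP/lc_scale/lc_sym/repr_lclass. Qed.

Let lE := (lclassN, lclassD, lclassM, lclassZ).

Lemma laddA : associative ladd.
Proof.
elim/lclass_ind=> x; elim/lclass_ind=> y; elim/lclass_ind=> z.
by rewrite -!lE; apply/lclassP/lc_addA.
Qed.

Lemma laddC : commutative ladd.
Proof.
by elim/lclass_ind=> x; elim/lclass_ind=> y; rewrite -!lE; apply/lclassP/lc_addC.
Qed.

Lemma ladd0 : left_id (lclass TZero) ladd.
Proof. by elim/lclass_ind=> x; rewrite -!lE; apply/lclassP/lc_add0. Qed.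

Lemma laddN : left_inverse (lclass TZero) lopp ladd.
Proof. by elim/lclass_ind=> x; rewrite -!lE; apply/lclassP/lc_addN. Qed.

HB.instance Definition _ :=
  GRing.isZmodule.Build leavitt laddA laddC ladd0 laddN.

Let lD x y : lclass (TAdd x y) = lclass x + lclass y := lclassD x y.
Let lN x : lclass (TOpp x) = - lclass x := lclassN x.
Let lE' := (lD, lclassM, lclassZ).

Lemma lscaleA a b u : lscale a (lscale b u) = lscale (a * b) u.
Proof.
by elim/lclass_ind: u => x; rewrite -!lE; apply/lclassP/lc_scaleA.
Qed.

Lemma lscale1 : left_id 1 lscale.
Proof. by elim/lclass_ind=> x; rewrite -!lE; apply/lclassP/lc_scale1. Qed.

Lemma lscaleDr : right_distributive lscale +%R.
Proof.
move=> a; elim/lclass_ind=> x; elim/lclass_ind=> y.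
by rewrite -!lE'; apply/lclassP/lc_scaleDr.
Qed.

Lemma lscaleDl u : {morph lscale^~ u : a b / a + b}.
Proof.
move=> a b; elim/lclass_ind: u => x.
by rewrite -!lE'; apply/lclassP/lc_scaleDl.
Qed.

HB.instance Definition _ :=
  GRing.Zmodule_isLmodule.Build k leavitt lscaleA lscale1 lscaleDr lscaleDl.

Let lZ a x : lclass (TScale a x) = a *: lclass x := lclassZ a x.

Lemma lmulA : associative lmul.
Proof.
elim/lclass_ind=> x; elim/lclass_ind=> y; elim/lclass_ind=> z.
by rewrite -!lE'; apply/lclassP/lc_mulA.
Qed.

Lemma lmulDl : left_distributive lmul +%R.
Proof.
elim/lclass_ind=> x; elim/lclass_ind=> y; elim/lclass_ind=> z.
by rewrite -!lE'; apply/lclassP/lc_mulDl.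
Qed.

Lemma lmulDr : right_distributive lmul +%R.
Proof.
elim/lclass_ind=> x; elim/lclass_ind=> y; elim/lclass_ind=> z.
by rewrite -!lE'; apply/lclassP/lc_mulDr.
Qed.

Lemma lscale_mull (a : k) (u v : leavitt) : a *: lmul u v = lmul (a *: u) v.
Proof.
elim/lclass_ind: u => x; elim/lclass_ind: v => y.
by rewrite -lclassM -!lZ -lclassM; apply/lclassP/lc_scaleAl.
Qed.

Lemma lscale_mulr (a : k) (u v : leavitt) : a *: lmul u v = lmul u (a *: v).
Proof.
elim/lclass_ind: u => x; elim/lclass_ind: v => y.
by rewrite -lclassM -!lZ -lclassM; apply/lclassP/lc_scaleAr.
Qed.

Definition Lvertex (v : vertex G) : leavitt := lclass (TVertex v).
Definition Larrow (e : arrow G) : leavitt := lclass (TArrow e).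
Definition Lghost (e : arrow G) : leavitt := lclass (TGhost e).

Definition lone : leavitt := \sum_(v : vertex G) Lvertex v.

Let Lmul0 u : lmul 0 u = 0.
Proof. by rewrite -[X in lmul X _](scale0r 0) -lscale_mull scale0r. Qed.

Let Lmulr0 u : lmul u 0 = 0.
Proof. by rewrite -[X in lmul _ X](scale0r 0) -lscale_mulr scale0r. Qed.

Let LV v w : lmul (Lvertex v) (Lvertex w) = if v == w then Lvertex v else 0.
Proof.
by rewrite -lclassM; have /lclassP-> := lc_V v w; case: (v == w).
Qed.

Let lone_mul v u : lmul (Lvertex v) u = u -> lmul lone u = u.
Proof.
move=> vu; rewrite -{1}vu lmulA (_ : lmul lone _ = Lvertex v) //.
rewrite /lone (big_morph (lmul^~ (Lvertex v)) (fun x y => lmulDl x y _) (Lmul0 _)).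
rewrite (bigD1 v) //= LV eqxx big1 ?addr0 // => w /negPf wv.
by rewrite LV wv.
Qed.

Let mul_lone v u : lmul u (Lvertex v) = u -> lmul u lone = u.
Proof.
move=> uv; rewrite -{1}uv -lmulA (_ : lmul _ lone = Lvertex v) //.
rewrite /lone (big_morph (lmul (Lvertex v)) (lmulDr _) (Lmulr0 _)).
rewrite (bigD1 v) //= LV eqxx big1 ?addr0 // => w /negPf wv.
by rewrite LV eq_sym wv.
Qed.

Lemma lmul1l : left_id lone lmul.
Proof.
elim/lclass_ind; elim=> [v|e|e||x IHx|x IHx y IHy|x IHx y IHy|a x IHx].
- by apply: (@lone_mul v); rewrite LV eqxx.
- by apply: (@lone_mul (src e)); rewrite -lclassM; apply/lclassP/lc_E_src.
- by apply: (@lone_mul (tgt e)); rewrite -lclassM; apply/lclassP/lc_E_src_ghost.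
- exact: Lmulr0.
- have -> : lclass (TOpp x) = (-1) *: lclass x by rewrite lN scaleN1r.
  by rewrite -lscale_mulr IHx.
- by rewrite lD lmulDr IHx IHy.
- by rewrite lclassM lmulA IHx.
- by rewrite lZ -lscale_mulr IHx.
Qed.

Lemma lmul1r : right_id lone lmul.
Proof.
elim/lclass_ind; elim=> [v|e|e||x IHx|x IHx y IHy|x IHx y IHy|a x IHx].
- by apply: (@mul_lone v); rewrite LV eqxx.
- by apply: (@mul_lone (tgt e)); rewrite -lclassM; apply/lclassP/lc_E_tgt.
- by apply: (@mul_lone (src e)); rewrite -lclassM; apply/lclassP/lc_E_tgt_ghost.
- exact: Lmul0.
- have -> : lclass (TOpp x) = (-1) *: lclass x by rewrite lN scaleN1r.
  by rewrite -lscale_mull IHx.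
- by rewrite lD lmulDl IHx IHy.
- by rewrite lclassM -lmulA IHy.
- by rewrite lZ -lscale_mull IHx.
Qed.

HB.instance Definition _ :=
  GRing.Zmodule_isPzRing.Build leavitt lmulA lmul1l lmul1r lmulDl lmulDr.

(* The algType structure of the library asks for 1 != 0, which fails when G   *)
(* has no vertex or k is trivial; these two lemmas complete the ring and      *)
(* module structures of leavitt.                                              *)
Lemma leavitt_scaleAl (a : k) (u v : leavitt) : a *: (u * v) = (a *: u) * v.
Proof. exact: lscale_mull. Qed.

Lemma leavitt_scaleAr (a : k) (u v : leavitt) : a *: (u * v) = u * (a *: v).
Proof. exact: lscale_mulr. Qed.

Implicit Types (p q C : gpath G).

Definition Lpath p : leavitt :=
  if parrows p is [::] then Lvertex (psrc p)
  else \prod_(e <- parrows p) Larrow e.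

Definition Lpath_star p : leavitt :=
  if parrows p is [::] then Lvertex (psrc p)
  else \prod_(e <- rev (parrows p)) Lghost e.

Definition Lcycle_pow C (n : int) : leavitt :=
  match n with
  | Posz 0 => Lvertex (psrc C)
  | Posz m.+1 => Lpath C ^+ m.+1
  | Negz m => Lpath_star C ^+ m.+1
  end.

End Presentation.

Section Basis.
Variable G : digraph.

Inductive basis_index : Type :=
  | SinkIndex of gpath G & gpath G
  | CycleIndex of gpath G & gpath G & int & gpath G.

Definition basis_index_valid (R : {pred gpath G}) (i : basis_index) : Prop :=
  match i with
  | SinkIndex p q => ptgt p = ptgt q /\ is_sink (ptgt p)
  | CycleIndex C p n q => [/\ C \in R, in_P C p & in_P C q]
  end.

Definition basis_elt (k : comPzRingType) (i : basis_index) : leavitt k G :=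
  match i with
  | SinkIndex p q => Lpath k p * Lpath_star k q
  | CycleIndex C p n q => Lpath k p * Lcycle_pow k C n * Lpath_star k q
  end.

End Basis.

(* The family (b i), for i ranging over D, is a basis of M; over a nontrivial *)
(* k, this entails that b is injective on D.                                  *)
Definition is_basis (k : comPzRingType) (M : lmodType k) (I : Type)
    (D : I -> Prop) (b : I -> M) : Prop :=
  (forall x : M, exists (n : nat) (i : 'I_n -> I) (c : 'I_n -> k),
     (forall j, D (i j)) /\ x = \sum_(j < n) c j *: b (i j)) /\
  (forall (n : nat) (i : 'I_n -> I) (c : 'I_n -> k),
     (forall j, D (i j)) -> injective i ->
     \sum_(j < n) c j *: b (i j) = 0 -> forall j, c j = 0).

(* Main.v *)
(* Spanning: since e^* f = delta_{e,f} te, the monomials p q^* with tp = tq   *)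
(* span the algebra.  Disjointness of cycles means that at most one arrow      *)
(* leaving a vertex v lies on a closed path; by (CK2), p q^* is congruent to   *)
(* (p e)(q e)^* for that arrow e, modulo monomials meeting at vertices that    *)
(* reach strictly fewer vertices than v.  Pushing along e brings tp to the     *)
(* base of its cycle, and pulling back along C turns C^m C^{* n} into a power  *)
(* of C.                                                                       *)
(* Independence: the algebra acts on the functions on (boundary path, degree), *)
(* where boundary paths are infinite or end at a sink.  At the point p C^oo,   *)
(* against the delta function at q C^oo in the right degree, a basis element   *)
(* other than p C^n q^* contributes only if its cycle reaches strictly more    *)
(* vertices than C, so coefficients vanish by induction; sinks come last.      *)
Require Import Defs.
From mathcomp Require Import all_boot all_order all_algebra.
From mathcomp Require Import boolp zify.
Set Implicit Arguments.
Unset Strict Implicit.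
Unset Printing Implicit Defensive.
Import GRing.Theory.
Local Open Scope ring_scope.

(** Disjointness enters through one fact, [cyclic_uniq]: at most one arrow leaving a vertex lies on
    a closed path. Every other arrow out of that vertex leads to a vertex reaching strictly fewer
    vertices, and [nreach] measures this.

    Spanning: the monomials s t^* span ([spanned_mon]). When a cyclic arrow e leaves the middle
    vertex, (CK2) replaces s t^* by (s e)(t e)^* up to lower terms ([mon_push]), and this works in
    both directions. Forwards, it moves the middle vertex to the base of its cycle C, where the
    monomial becomes p C^m (q C^l)^* with p and q in P_C; backwards, it cancels common copies of C,
    leaving one power of C. Induction on [nreach] gives [mon_inB].

    Independence: in the action on functions of a stream and a degree, [coef i i0 g] is a matrix
    entry of the element i at a point built from i0. It is 1 for i = i0. By [coef_cycle] and
    [coef_sink], a nonzero entry with i distinct from i0 forces i to be a cycle index, and, when i0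
    is one too, the cycle of i to reach strictly more vertices. The system is thus triangular, and
    [basis_free] solves it. *)

(** * Words of arrows, reachability and cyclic arrows *)

Section Words.
Variable G : digraph.
Implicit Types (u v w : vertex G) (e f : arrow G) (s t r : seq (arrow G)).
Implicit Types (p q C D : gpath G).

(** Words are read relative to the vertex v where they should end, so that the empty word is the
    trivial path at v and concatenation needs no case analysis. *)
Definition start s v : vertex G := if s is e :: _ then src e else v.

Fixpoint ends s v : bool :=
  if s is e :: s' then (tgt e == start s' v) && ends s' v else true.

Lemma start_cat s t v : start (s ++ t) v = start s (start t v).
Proof. by case: s. Qed.

Lemma ends_cat s t v : ends (s ++ t) v = ends s (start t v) && ends t v.
Proof. by elim: s => //= e s ->; rewrite start_cat andbA. Qed.

Lemma ends_last e s v : ends (e :: s) v -> last (tgt e) [seq tgt f | f <- s] = v.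
Proof.
elim: s e => [|f s IHs] e /=; first by rewrite andbT => /eqP.
by case/andP=> _; apply: IHs.
Qed.

Lemma path_ends e s :
  path (fun e f => tgt e == src f) e s
    = ends (e :: s) (last (tgt e) [seq tgt f | f <- s]).
Proof. by elim: s e => [|f s IHs] e /=; rewrite ?eqxx // IHs. Qed.

Lemma gpath_start p v : parrows p != [::] -> start (parrows p) v = psrc p.
Proof. by case: p => -[u [|e s]] up //=; case/andP: (up) => /eqP. Qed.

Lemma gpath_start_tgt p : start (parrows p) (ptgt p) = psrc p.
Proof. by case: p => -[u [|e s]] up //=; case/andP: (up) => /eqP. Qed.

Lemma gpath_ends p : ends (parrows p) (ptgt p).
Proof. by case: p => -[u [|e s]] up //; case/andP: (up) => _; rewrite path_ends. Qed.

Lemma ends_gpath s v : ends s v ->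
  exists p, [/\ parrows p = s, psrc p = start s v & ptgt p = v].
Proof.
move=> sv; have Hp : is_path (start s v) s.
  by case: s sv => //= e s sv; rewrite eqxx path_ends (ends_last sv).
exists (@GPath G (start s v, s) Hp); split=> //.
by rewrite /ptgt /psrc /parrows /=; case: s sv {Hp} => //= e s /ends_last.
Qed.

Lemma gpath_inj p q : parrows p = parrows q -> ptgt p = ptgt q -> p = q.
Proof.
move=> pq tpq; apply/val_inj; rewrite /= [pval p]surjective_pairing.
rewrite [pval q]surjective_pairing -/(psrc p) -/(psrc q).
by rewrite -!gpath_start_tgt -/(parrows p) -/(parrows q) pq tpq.
Qed.

Lemma cycleP C : is_cycle C ->
  [/\ parrows C != [::], ends (parrows C) (psrc C),
      forall v, start (parrows C) v = psrc C
    & uniq [seq src e | e <- parrows C]].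
Proof.
case/and3P=> C0 /eqP sC uC; split=> // [|v]; last exact: gpath_start.
by rewrite sC gpath_ends.
Qed.

Lemma cycle_of_word e s : ends (e :: s) (src e) ->
  uniq [seq src f | f <- e :: s] -> exists2 C, is_cycle C & parrows C = e :: s.
Proof.
move=> es ues; have [C [Ces sC tC]] := ends_gpath es.
by exists C; rewrite // /is_cycle sC tC Ces /= eqxx.
Qed.

Definition reach u v : Prop := exists2 s, ends s v & start s v = u.

Lemma reach_refl v : reach v v.
Proof. by exists [::]. Qed.

Lemma reach_trans u v w : reach v u -> reach u w -> reach v w.
Proof.
case=> s su <- [t tw tu]; exists (s ++ t); last by rewrite start_cat tu.
by rewrite ends_cat tu su.
Qed.

Lemma reach_arrow e : reach (src e) (tgt e).
Proof. by exists [:: e]; rewrite /= ?eqxx. Qed.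

(** Loop erasure: when the source of the first arrow occurs again later, the word is entered at that
    later occurrence instead. *)
Lemma simple_word s w u : ends s w -> u \in rcons [seq src e | e <- s] w ->
  exists t, [/\ ends t w, start t w = u, uniq (rcons [seq src e | e <- t] w)
    & {subset [seq src e | e <- t] <= [seq src e | e <- s]}].
Proof.
elim: s u => [|e s IHs] u /=.
  by rewrite inE => _ /eqP ->; exists [::].
case/andP=> /eqP te sw; rewrite inE => /orP[/eqP ->|us]; last first.
  have [t [tw tu ut st]] := IHs _ sw us.
  by exists t; split=> // x /st; rewrite inE orbC => ->.
have [es|es] := boolP (src e \in rcons [seq src e | e <- s] w).
  have [t [tw tu ut st]] := IHs _ sw es.
  by exists t; split=> // x /st; rewrite inE orbC => ->.
have hs : tgt e \in rcons [seq src e | e <- s] w.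
  by rewrite te; case: (s) => [|f s'] /=; rewrite inE eqxx.
have [t [tw tu ut st]] := IHs _ sw hs.
exists (e :: t); split=> //=; first by rewrite tu eqxx tw.
  rewrite ut andbT; apply: contra es; rewrite !mem_rcons !inE.
  by case/orP=> [->//|/st ->]; rewrite orbT.
by move=> x; rewrite !inE => /orP[->//|/st ->]; rewrite orbT.
Qed.

Definition cyclic e : Prop := reach (tgt e) (src e).

Lemma closed_cyclic s v e : ends s v -> start s v = v -> e \in s -> cyclic e.
Proof.
move=> sv svv /splitPr es; case: es sv svv => a b.
rewrite ends_cat start_cat /= => /and3P[av /eqP te bv] svv.
apply: (@reach_trans v); first by exists b.
by exists a.
Qed.

(** A word from [tgt e] back to [src e], once made simple, closes up with e to a cycle. *)
Lemma cyclic_cycle e : cyclic e ->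
  exists2 C, is_cycle C & exists s, parrows C = e :: s.
Proof.
case=> s se te.
have /(simple_word se)[t [te' tt ut _]] : tgt e \in rcons [seq src e | e <- s] (src e).
  by rewrite -te; case: (s) => [|f s'] /=; rewrite inE eqxx.
have [||C Cc Ce] := @cycle_of_word e t; first by rewrite /= tt eqxx.
  by rewrite /= -rcons_uniq.
by exists C => //; exists t.
Qed.

(* Strictly decreases along arrows that lie on no closed path. *)
Definition nreach v : nat := #|[set w | `[< reach v w >]]|.

Lemma nreach_le u v : reach u v -> (nreach v <= nreach u)%N.
Proof.
move=> uv; apply: subset_leq_card; apply/subsetP=> w; rewrite !inE.
by move=> /asboolP vw; apply/asboolP; apply: reach_trans vw.
Qed.

Lemma nreach_lt u v : reach u v -> ~ reach v u -> (nreach v < nreach u)%N.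
Proof.
move=> uv vu; apply: proper_card; apply/properP; split.
  apply/subsetP=> w; rewrite !inE.
  by move=> /asboolP vw; apply/asboolP; apply: reach_trans vw.
exists u; rewrite inE; first exact/asboolP/reach_refl.
by apply/asboolP.
Qed.

Lemma nreach_cyclic e : cyclic e -> nreach (tgt e) = nreach (src e).
Proof.
move=> ce; apply/eqP; rewrite eqn_leq !nreach_le //; exact: reach_arrow.
Qed.

Lemma start_rot n s v : start s v = v -> start (rot n s) v = start (drop n s) v.
Proof.
move=> sv; rewrite /rot start_cat; case: (drop n s) => //=.
by case: (s) n sv => [|e s'] [].
Qed.

Hypothesis disj : cycles_pairwise_disjoint G.

(** The cycles through e and f share a vertex, so they are rotations of each other; both arrows then
    lie on one cycle, whose sources are distinct. *)
Lemma cyclic_uniq e f : cyclic e -> cyclic f -> src e = src f -> e = f.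
Proof.
move=> /cyclic_cycle[C Cc [s Ce]] /cyclic_cycle[D Dc [t Df]] sef.
have [|CD] := EM (cycle_equiv C D); last first.
  case: (disj Cc Dc CD (v := src e)); rewrite /cycle_vertices Ce Df /= sef.
  by rewrite !mem_head.
case=> n CD; have [_ _ _ uC] := cycleP Cc.
have fC : f \in parrows C by rewrite -(mem_rot n) -CD Df mem_head.
have eC : e \in parrows C by rewrite Ce mem_head.
have inj : {in parrows C &, injective (fun e => src e)}.
  by move: uC; elim: (parrows C) => // a l IHl /= /andP[al ul] x y;
    rewrite !inE => /orP[/eqP->|xl] /orP[/eqP->|yl] // xy;
    [case/negP: al; rewrite xy map_f|case/negP: al; rewrite -xy map_f|apply: IHl].
exact: inj.
Qed.

Variable R : {pred gpath G}.
Hypothesis reps : cycle_representatives R.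

Lemma rep_cycle C : C \in R -> is_cycle C.
Proof. by case: reps => H _; apply: H. Qed.

(** The representative C is the rotation by some n of a cycle D starting with e; the first n arrows
    of D lead from [src e] to the base of C. *)
Lemma cyclic_rep e : cyclic e ->
  exists2 C, C \in R & exists s,
    [/\ ends s (psrc C), start s (psrc C) = src e & forall f, f \in s -> cyclic f].
Proof.
move=> /cyclic_cycle[D Dc [s De]]; have [_ /(_ D Dc)[C [[CR [n DC]] _]]] := reps.
exists C => //; have [D0 Dends Dstart _] := cycleP Dc.
have sD : psrc D = src e by rewrite -(Dstart (psrc D)) De.
have sC : start (drop n (parrows D)) (psrc D) = psrc C.
  rewrite -start_rot // -DC; have [_ _ -> //] := cycleP (rep_cycle CR).
move: (Dends); rewrite -{1}(cat_take_drop n (parrows D)) ends_cat sC.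
case/andP=> et ed; exists (take n (parrows D)); split=> //.
  by rewrite -sC -start_cat cat_take_drop Dstart.
by move=> f /mem_take; apply: closed_cyclic Dends _.
Qed.

End Words.

(** * Linear spans of families *)

Section Span.
Variable k : comPzRingType.

Definition spanned (M : lmodType k) (I : Type) (D : I -> Prop) (b : I -> M) x :=
  exists (n : nat) (i : 'I_n -> I) (c : 'I_n -> k),
    (forall j, D (i j)) /\ x = \sum_(j < n) c j *: b (i j).

Section Closure.
Variables (M : lmodType k) (I : Type) (D : I -> Prop) (b : I -> M).

Lemma spanned0 : spanned D b 0.
Proof.
(* The index type may be empty, so the empty family is defined by absurdity. *)
exists 0%N, (fun j : 'I_0 => False_rect I (notF (ltn_ord j))), (fun=> 0).
by split=> [[]|]; rewrite ?big_ord0.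
Qed.

Lemma spanned_gen i : D i -> spanned D b (b i).
Proof.
by move=> Di; exists 1%N, (fun=> i), (fun=> 1); rewrite big_ord1 scale1r.
Qed.

Lemma spannedD x y : spanned D b x -> spanned D b y -> spanned D b (x + y).
Proof.
move=> [n [i [c [Di ->]]]] [m [j [d [Dj ->]]]].
exists (n + m)%N,
  (fun l => match split l with inl l1 => i l1 | inr l2 => j l2 end),
  (fun l => match split l with inl l1 => c l1 | inr l2 => d l2 end).
split=> [l|]; first by case: (split l).
rewrite big_split_ord /=; congr (_ + _); apply: eq_bigr => l _.
  by rewrite (unsplitK (inl l)).
by rewrite (unsplitK (inr l)).
Qed.

Lemma spannedZ a x : spanned D b x -> spanned D b (a *: x).
Proof.
move=> [n [i [c [Di ->]]]]; exists n, i, (fun j => a * c j); split=> //.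
by rewrite scaler_sumr; apply: eq_bigr => j _; rewrite scalerA.
Qed.

Lemma spannedB x y : spanned D b x -> spanned D b y -> spanned D b (x - y).
Proof. by move=> bx b_y; rewrite -scaleN1r; apply/spannedD/spannedZ. Qed.

Lemma spanned_sum (J : finType) (P : pred J) (F : J -> M) :
  (forall j, P j -> spanned D b (F j)) -> spanned D b (\sum_(j | P j) F j).
Proof. by move=> bF; apply: big_ind => //; [apply: spanned0|apply: spannedD]. Qed.

End Closure.

Lemma spanned_map (M M' : lmodType k) (I I' : Type) (D : I -> Prop)
    (D' : I' -> Prop) (b : I -> M) (b' : I' -> M') (f : M -> M') :
  f 0 = 0 -> {morph f : x y / x + y} -> (forall a, {morph f : x / a *: x}) ->
  (forall i, D i -> spanned D' b' (f (b i))) ->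
  forall x, spanned D b x -> spanned D' b' (f x).
Proof.
move=> f0 fD fZ fb x [n [i [c [Di ->]]]]; rewrite (big_morph f fD f0).
by apply: spanned_sum => j _; rewrite fZ; apply/spannedZ/fb.
Qed.

End Span.

(** * Monomials s v t^* in the Leavitt path algebra *)

Section Monomials.
Variables (k : comPzRingType) (G : digraph).
Implicit Types (u v w : vertex G) (e f : arrow G) (s t r : seq (arrow G)).
Implicit Types (p q C D : gpath G).
Local Notation L := (leavitt k G).
Local Notation LV := (@Lvertex k G).
Local Notation LE := (@Larrow k G).
Local Notation LG := (@Lghost k G).

Lemma lclass_mul x y : lclass (TMul x y) = lclass x * lclass y :> L.
Proof. exact: lclassM. Qed.

Lemma lclass_add x y : lclass (TAdd x y) = lclass x + lclass y :> L.
Proof. exact: lclassD. Qed.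

Lemma lclass_scale a x : lclass (TScale a x) = a *: lclass x :> L.
Proof. exact: lclassZ. Qed.

Lemma lclass_opp x : lclass (TOpp x) = - lclass x :> L.
Proof. exact: lclassN. Qed.

Lemma mulLVV v w : LV v * LV w = if v == w then LV v else 0.
Proof. by rewrite -lclass_mul; have /lclassP-> := lc_V k v w; case: eqP. Qed.

Lemma mulLVE e : LV (src e) * LE e = LE e.
Proof. by rewrite -lclass_mul; apply/lclassP/lc_E_src. Qed.

Lemma mulLEV e : LE e * LV (tgt e) = LE e.
Proof. by rewrite -lclass_mul; apply/lclassP/lc_E_tgt. Qed.

Lemma mulLVG e : LV (tgt e) * LG e = LG e.
Proof. by rewrite -lclass_mul; apply/lclassP/lc_E_src_ghost. Qed.

Lemma mulLGV e : LG e * LV (src e) = LG e.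
Proof. by rewrite -lclass_mul; apply/lclassP/lc_E_tgt_ghost. Qed.

Lemma mulLGE e f : LG e * LE f = if e == f then LV (tgt e) else 0.
Proof. by rewrite -lclass_mul; have /lclassP-> := lc_CK1 k e f; case: eqP. Qed.

Lemma LV_CK2 v : ~~ is_sink v -> LV v = \sum_(e | src e == v) LE e * LG e.
Proof.
move=> /(lc_CK2 k)/lclassP; rewrite -/(LV v) => ->.
rewrite (big_morph (@lclass k G) lclass_add (erefl 0)).
by apply: eq_bigr => e _; rewrite lclass_mul.
Qed.

Definition mon s v t : L :=
  (\prod_(e <- s) LE e) * LV v * \prod_(e <- rev t) LG e.

Lemma LV_prod v s w :
  LV v * ((\prod_(e <- s) LE e) * LV w)
    = if v == start s w then (\prod_(e <- s) LE e) * LV w else 0.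
Proof.
case: s => [|e s] /=.
  by rewrite big_nil mul1r mulLVV; case: eqP => // ->.
by rewrite big_cons -[LE e]mulLVE !mulrA mulLVV; case: eqP => [->|_]; rewrite ?mul0r.
Qed.

Lemma LV_mon v s w t :
  LV v * mon s w t = if v == start s w then mon s w t else 0.
Proof. by rewrite /mon !mulrA -(mulrA (LV v)) LV_prod; case: eqP; rewrite ?mul0r. Qed.

Lemma LE_mon e s w t : LE e * mon s w t = mon (e :: s) w t.
Proof. by rewrite /mon big_cons !mulrA. Qed.

Lemma LG_mon_cons e f s w t :
  LG e * mon (f :: s) w t = if e == f then LV (tgt e) * mon s w t else 0.
Proof.
by rewrite -LE_mon mulrA mulLGE; case: eqP; rewrite ?mul0r.
Qed.

(** A ghost that meets no arrow lengthens the right-hand word, since e^* t^* = (t e)^*. *)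
Lemma LG_mon_nil e w t :
  LG e * mon [::] w t = if src e == w then mon [::] (tgt e) (rcons t e) else 0.
Proof.
rewrite /mon !big_nil !mul1r -{1}mulLGV -!mulrA (mulrA (LV _)) mulLVV.
case: eqP => [_|]; last by rewrite mul0r mulr0.
by rewrite rev_rcons big_cons !mulrA mulLGV mulLVG.
Qed.

Lemma mon_arrows0 s v t : ~~ ends s v -> mon s v t = 0.
Proof.
elim: s => //= e s IHs; rewrite negb_and -LE_mon => /orP[es|/IHs ->].
  by rewrite -mulLEV -mulrA LV_mon (negPf es) mulr0.
by rewrite mulr0.
Qed.

(** Each ghost absorbs the vertices at its two ends, so the vertex in front tests whether t is a
    path ending at v. *)
Lemma ghosts_start v t :
  LV v * \prod_(e <- rev t) LG e
    = if ends t v then LV v * (\prod_(e <- rev t) LG e) * LV (start t v) else 0.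
Proof.
elim: t => [|e t IHt] /=; first by rewrite big_nil mulr1 mulLVV eqxx.
rewrite rev_cons -cats1 big_cat big_seq1 /= -[LG e]mulLVG !mulrA IHt.
case: (ends t v); last by rewrite !mul0r andbF.
rewrite -(mulrA _ (LV _) (LV _)) mulLVV eq_sym andbT.
case: eqP => [<-|_]; last by rewrite mulr0 mul0r.
by rewrite -!mulrA mulLGV mulLVG.
Qed.

Lemma mon_ghosts0 s v t : ~~ ends t v -> mon s v t = 0.
Proof. by rewrite /mon -mulrA ghosts_start => /negPf->; rewrite mulr0. Qed.

Lemma mon_CK2 s v t : ~~ is_sink v ->
  mon s v t = \sum_(e | src e == v) mon (rcons s e) (tgt e) (rcons t e).
Proof.
move=> /LV_CK2 Ev; rewrite {1}/mon Ev mulr_sumr mulr_suml; apply: eq_bigr => e _.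
rewrite /mon -cats1 big_cat big_seq1 rev_rcons big_cons /=.
by rewrite -!mulrA (mulrA (LV _)) mulLVG.
Qed.

Lemma Lpath_prod p v : ptgt p = v ->
  Lpath k p = (\prod_(e <- parrows p) LE e) * LV v.
Proof.
move=> <-; have := gpath_start_tgt p; have := gpath_ends p; rewrite /Lpath.
case/lastP: (parrows p) => [|s e] /=; first by rewrite big_nil mul1r => _ ->.
rewrite -cats1 ends_cat /= andbT => /andP[_ /eqP <-] _.
case: s => [|f s] /=; first by rewrite !big_seq1 mulLEV.
by rewrite -cat_cons big_cat big_seq1 -mulrA mulLEV.
Qed.

Lemma Lpath_star_prod p v : ptgt p = v ->
  Lpath_star k p = LV v * \prod_(e <- rev (parrows p)) LG e.
Proof.
move=> <-; have := gpath_start_tgt p; have := gpath_ends p; rewrite /Lpath_star.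
case/lastP: (parrows p) => [|s e] /=; first by rewrite big_nil mulr1 => _ ->.
rewrite -cats1 ends_cat /= andbT => /andP[_ /eqP <-] _.
by case: s => [|f s]; rewrite rev_cat /= big_cons mulrA mulLVG.
Qed.

Definition pow C n : seq (arrow G) := flatten (nseq n (parrows C)).
Arguments pow : simpl never.

Lemma Lpath_pow C n : is_cycle C ->
  Lpath k C ^+ n.+1 = \prod_(e <- pow C n.+1) LE e.
Proof.
case/and3P=> C0 _ _; have ->: Lpath k C = \prod_(e <- parrows C) LE e.
  by rewrite /Lpath; case: (parrows C) C0.
rewrite /pow; elim: {n}n.+1 => [|n IHn]; first by rewrite big_nil.
by rewrite exprS big_cat IHn.
Qed.

Lemma Lpath_star_pow C n : is_cycle C ->
  Lpath_star k C ^+ n.+1 = \prod_(e <- rev (pow C n.+1)) LG e.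
Proof.
case/and3P=> C0 _ _; have ->: Lpath_star k C = \prod_(e <- rev (parrows C)) LG e.
  by rewrite /Lpath_star; case: (parrows C) C0.
rewrite /pow; elim: {n}n.+1 => [|n IHn]; first by rewrite big_nil.
by rewrite exprSr rev_cat big_cat IHn.
Qed.

Definition basis_left (i : basis_index G) : seq (arrow G) :=
  match i with
  | SinkIndex p q => parrows p
  | CycleIndex C p (Posz n) q => parrows p ++ pow C n
  | CycleIndex C p (Negz n) q => parrows p
  end.

Definition basis_mid (i : basis_index G) : vertex G :=
  match i with SinkIndex p q => ptgt p | CycleIndex C p n q => psrc C end.

Definition basis_right (i : basis_index G) : seq (arrow G) :=
  match i with
  | SinkIndex p q => parrows q
  | CycleIndex C p (Posz n) q => parrows q
  | CycleIndex C p (Negz n) q => parrows q ++ pow C n.+1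
  end.

Lemma pow_start C n : is_cycle C -> start (pow C n) (psrc C) = psrc C.
Proof.
rewrite /pow; case/cycleP=> _ _ Cstart _.
by case: n => //= n; rewrite start_cat Cstart.
Qed.

Lemma pow_ends C n : is_cycle C -> ends (pow C n) (psrc C).
Proof.
move=> Cc; have [_ Cends _ _] := cycleP Cc; elim: n => // n IHn.
by rewrite [pow C _]/(parrows C ++ pow C n) ends_cat pow_start // Cends.
Qed.

Lemma basis_elt_mon (R : {pred gpath G}) i :
  (forall C, C \in R -> is_cycle C) -> basis_index_valid R i ->
  basis_elt k i = mon (basis_left i) (basis_mid i) (basis_right i).
Proof.
move=> Rc; case: i => [p q|C p n q] /=.
  case=> tpq _; rewrite (Lpath_prod (erefl _)) (Lpath_star_prod (esym tpq)).
  by rewrite /mon -!mulrA (mulrA (LV _) (LV _)) mulLVV eqxx.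
case=> /Rc Cc [tp _] [tq _]; rewrite (Lpath_prod tp) (Lpath_star_prod tq) /mon.
case: n => [[|n]|n] /=.
- rewrite /pow /= cats0 -!mulrA (mulrA (LV _) (LV _)) mulLVV eqxx.
  by rewrite (mulrA (LV _) (LV _)) mulLVV eqxx.
- rewrite (Lpath_pow _ Cc) [\prod_(e <- parrows p ++ _) _]big_cat /= -!mulrA.
  congr (_ * _).
  have := LV_prod (psrc C) (pow C n.+1) (psrc C).
  by rewrite pow_start // eqxx !mulrA => ->.
- rewrite (Lpath_star_pow _ Cc) rev_cat [\prod_(e <- _ ++ _) _]big_cat /= -!mulrA.
  congr (_ * _).
  have := ghosts_start (psrc C) (pow C n.+1).
  by rewrite pow_ends // pow_start // !mulrA => <-.
Qed.

(** The span of the monomials is stable under left multiplication by each generator, hence by every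
    term, and it contains the sum of the vertices, which is 1. *)
Lemma spanned_mon (x : L) :
  spanned (fun=> True) (fun i => mon i.1.1 i.1.2 i.2) x.
Proof.
set D := fun=> True; set b := fun i => _.
have Sm s v t : spanned D b (mon s v t) by apply: (@spanned_gen _ _ _ D b (s, v, t)).
have SV v s w t : spanned D b (LV v * mon s w t).
  by rewrite LV_mon; case: eqP => _; [|apply: spanned0].
have Slin (a u : L) : spanned D b u ->
    (forall s v t, spanned D b (a * mon s v t)) -> spanned D b (a * u).
  move=> Su Sa; apply: spanned_map Su => [|y1 y2|c y1|[[s v] t] _]; last exact: Sa.
  - exact: mulr0.
  - exact: mulrDr.
  - exact/esym/leavitt_scaleAr.
suff Smul y (u : L) : spanned D b u -> spanned D b (lclass y * u).
  elim/lclass_ind: x => x; rewrite -[lclass x]mulr1; apply: Smul.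
  apply: spanned_sum => v _; have := Sm [::] v [::].
  by rewrite /mon !big_nil mul1r mulr1.
elim: y u => [v|e|e||y IHy|y IHy z IHz|y IHy z IHz|a y IHy] u Su.
- by apply: Slin Su _ => s w t; apply: SV.
- by apply: Slin Su _ => s w t; rewrite -/(LE e) LE_mon.
- apply: Slin Su _ => -[|f s] w t; rewrite -/(LG e).
    by rewrite LG_mon_nil; case: eqP => _; [|apply: spanned0].
  by rewrite LG_mon_cons; case: eqP => _; [|apply: spanned0].
- by rewrite (_ : lclass _ = 0) // mul0r; apply: spanned0.
- by rewrite lclass_opp mulNr -scaleN1r; apply/spannedZ/IHy.
- by rewrite lclass_add mulrDl; apply: spannedD; [apply: IHy|apply: IHz].
- by rewrite lclass_mul -mulrA; apply/IHy/IHz.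
- by rewrite lclass_scale -leavitt_scaleAl; apply/spannedZ/IHy.
Qed.

End Monomials.

(** * Spanning by the basis elements *)

Section Spanning.
Variables (k : comPzRingType) (G : digraph) (R : {pred gpath G}).
Hypothesis disj : cycles_pairwise_disjoint G.
Hypothesis reps : cycle_representatives R.
Implicit Types (u v w : vertex G) (e f : arrow G) (s t r : seq (arrow G)).
Implicit Types (p q C D : gpath G).
Local Notation inB := (spanned (basis_index_valid R) (@basis_elt G k)).
Local Notation mon := (mon k).

(** Whatever precedes C in a path is itself a path to the base of C, so the condition on paths q may
    be put on arbitrary words. *)
Lemma in_P_words C p : is_cycle C ->
  in_P C p <-> ptgt p = psrc C /\ forall s, parrows p <> s ++ parrows C.
Proof.
move=> /cycleP[C0 Cends Cstart _]; split=> -[tp Hp]; split=> //.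
  move=> s ps; have := gpath_ends p; rewrite tp ps ends_cat Cstart.
  case/andP=> /ends_gpath[q].
  case=> qs sq tq _; apply: (Hp q tq); rewrite qs -ps sq.
  rewrite [pval p]surjective_pairing -/(psrc p) -/(parrows p); congr (_, _).
  by rewrite -gpath_start_tgt ps start_cat Cstart.
by move=> q tq pq; apply: (Hp (parrows q)); rewrite /parrows pq.
Qed.

Lemma powSr C n : pow C n.+1 = pow C n ++ parrows C.
Proof. by rewrite /pow -addn1 nseqD flatten_cat /= cats0. Qed.

Lemma strip_cycle C s : is_cycle C -> ends s (psrc C) ->
  exists p n, in_P C p /\ s = parrows p ++ pow C n.
Proof.
move=> Cc; have [C0 Cends Cstart _] := cycleP Cc.
have [m] := ubnP (size s); elim: m s => // m IHm s sm sC.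
have [[s' ss]|Hs] := EM (exists s', s = s' ++ parrows C).
  have s'C : ends s' (psrc C) by move: sC; rewrite ss ends_cat Cstart => /andP[].
  have [|p [n [Pp s'p]]] := IHm s' _ s'C.
    move: sm; rewrite ss size_cat ltnS; apply: leq_trans.
    by rewrite -addn1 leq_add2l lt0n size_eq0.
  by exists p, n.+1; rewrite powSr catA -s'p.
have [p [ps sp tp]] := ends_gpath sC; exists p, 0%N; rewrite cats0 ps; split=> //.
by apply/in_P_words => //; split=> // s' ps'; apply: Hs; exists s'; rewrite -ps.
Qed.

(** In (CK2) at [src e], every arrow f other than e is not cyclic by [cyclic_uniq], so [tgt f]
    cannot reach back and has smaller [nreach]; [low] then disposes of these terms. *)
Lemma mon_push e s t :
  cyclic e ->
  (forall s w t, (nreach w < nreach (src e))%N -> inB (mon s w t)) ->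
  inB (mon s (src e) t) <->
  inB (mon (rcons s e) (tgt e) (rcons t e)).
Proof.
move=> ce low; have nsink : ~~ is_sink (src e).
  by apply/forallPn; exists e; rewrite negbK.
rewrite (mon_CK2 k s t nsink) (bigD1 e) //=; set y := \sum_(_ | _) _.
have Sy : inB y.
  apply: spanned_sum => f /andP[/eqP sf fe]; apply: low; rewrite -sf.
  apply: nreach_lt; first exact: reach_arrow.
  by move=> cf; case/eqP: fe; apply: (cyclic_uniq disj).
split=> Sx; last exact: spannedD.
by rewrite -[X in spanned _ _ X](addrK y); apply: spannedB.
Qed.

Lemma mon_push_word r s t v :
  ends r v -> (forall e, e \in r -> cyclic e) ->
  (forall s w t, (nreach w < nreach (start r v))%N -> inB (mon s w t)) ->
  inB (mon s (start r v) t) <-> inB (mon (s ++ r) v (t ++ r)).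
Proof.
elim: r s t => [|e r IHr] s t /=; first by rewrite !cats0.
case/andP=> /eqP te rv cr low; have ce := cr e (mem_head _ _).
rewrite mon_push // te -!cat_rcons; apply: IHr => //.
  by move=> f fr; apply: cr; rewrite inE fr orbT.
by move=> s' w t'; rewrite -te nreach_cyclic //; apply: low.
Qed.

(** By induction on [nreach v]. A cyclic arrow out of v allows a push to the base of a cycle; at a
    sink the monomial is already a basis element; at any other v, (CK2) yields only lower terms. *)
Lemma mon_inB s v t : inB (mon s v t).
Proof.
have [n] := ubnP (nreach v); elim: n s v t => // n IHn s v t vn.
have low s' w t' : (nreach w < nreach v)%N -> inB (mon s' w t').
  by move=> wv; apply: IHn; lia.
have [sv|/mon_arrows0->] := boolP (ends s v); last exact: spanned0.
have [tv|/mon_ghosts0->] := boolP (ends t v); last exact: spanned0.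
have [[e sev ce]|ncyc] := EM (exists2 e, src e = v & cyclic e).
  have [C CR [r [rC sr cr]]] := cyclic_rep reps ce.
  have Cc := rep_cycle reps CR; have [C0 Cends Cstart _] := cycleP Cc.
  rewrite -sev -sr; rewrite mon_push_word //; last by rewrite sr sev.
  have [p [m [Pp ->]]] : exists p n, in_P C p /\ s ++ r = parrows p ++ pow C n.
    by apply: strip_cycle => //; rewrite ends_cat rC sr sev sv.
  have [q [l [Pq ->]]] : exists p n, in_P C p /\ t ++ r = parrows p ++ pow C n.
    by apply: strip_cycle => //; rewrite ends_cat rC sr sev tv.
  (* The monomial is now p C^m (q C^l)^*. If m or l is 0 it is a basis element. *)
  elim: m l => [|m IHm] l.
    case: l => [|l].
      have Hi : basis_index_valid R (CycleIndex C p 0 q) by [].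
      have := spanned_gen (@basis_elt G k) Hi.
      by rewrite (basis_elt_mon k (rep_cycle reps) Hi) /= /pow /= !cats0.
    have Hi : basis_index_valid R (CycleIndex C p (Negz l) q) by [].
    have := spanned_gen (@basis_elt G k) Hi.
    by rewrite (basis_elt_mon k (rep_cycle reps) Hi) /= /pow /= !cats0.
  case: l => [|l].
    have Hi : basis_index_valid R (CycleIndex C p m.+1 q) by [].
    have := spanned_gen (@basis_elt G k) Hi.
    by rewrite (basis_elt_mon k (rep_cycle reps) Hi) /= /pow /= !cats0.
  (* Both exponents are positive: pulling back once around C removes one copy of C from each
     side. *)
  rewrite !powSr !catA -mon_push_word ?Cstart //.
    by move=> f; apply: closed_cyclic Cends _; rewrite Cstart.
  move=> s' w t' wC; apply: low; apply: leq_trans wC _; apply: nreach_le.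
  by rewrite -sev; exists r.
have [vs|nvs] := boolP (is_sink v); last first.
  rewrite (mon_CK2 k s t nvs); apply: spanned_sum => e /eqP sev; apply: low.
  rewrite -sev; apply: nreach_lt; first exact: reach_arrow.
  by move=> ce; apply: ncyc; exists e.
have [p [<- _ tp]] := ends_gpath sv; have [q [<- _ tq]] := ends_gpath tv.
have Hi : basis_index_valid R (SinkIndex p q) by rewrite /= tp tq.
have := spanned_gen (@basis_elt G k) Hi.
by rewrite (basis_elt_mon k (rep_cycle reps) Hi) /= tp.
Qed.

Lemma basis_spans (x : leavitt k G) : inB x.
Proof.
(* With the identity as the linear map, this is transitivity of spanning. *)
by apply: spanned_map (spanned_mon x) => // -[[s v] t] _; apply: mon_inB.
Qed.

End Spanning.

(** * The action on functions of a boundary path and a degree *)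

Section Action.
Variables (k : comPzRingType) (G : digraph).
Implicit Types (u v w : vertex G) (e : arrow G) (s t r : seq (arrow G)).

(* A path ending at a sink v continues with inr v forever.  Streams that are  *)
(* not valid are kept in the type; the operators below vanish on them.        *)
Definition boundary : Type := nat -> arrow G + vertex G.
Implicit Types (f g h : boundary).

Definition origin (x : arrow G + vertex G) : vertex G :=
  match x with inl e => src e | inr v => v end.

Definition valid f : Prop :=
  forall n, match f n with
            | inl e => tgt e = origin (f n.+1)
            | inr v => is_sink v
            end.

Definition scons e f : boundary := fun n => if n is n'.+1 then f n' else inl e.
Definition shift f : boundary := fun n => f n.+1.
Definition scat s f : boundary := foldr scons f s.

Lemma scons_shift e f : f 0%N = inl e -> scons e (shift f) = f.
Proof. by move=> f0; apply/funext => -[]. Qed.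

Lemma valid_shift f : valid f -> valid (shift f).
Proof. by move=> fv n; apply: (fv n.+1). Qed.

Lemma valid_scons e f : valid (scons e f) <-> origin (f 0%N) = tgt e /\ valid f.
Proof.
split=> [fv|[fe fv] [|n]]; [split|by rewrite /= fe|exact: fv].
  exact/esym/(fv 0%N).
exact: valid_shift fv.
Qed.

Lemma valid_scat s f :
  valid (scat s f) <-> ends s (origin (f 0%N)) /\ valid f.
Proof.
elim: s => [|e s IHs] /=; first by split=> // -[].
have sE : origin (scat s f 0%N) = start s (origin (f 0%N)) by case: (s).
rewrite valid_scons IHs sE; split=> [[-> [-> fv]]|[/andP[/eqP-> ->] fv]] //.
by rewrite eqxx.
Qed.

Lemma scat_cat s t f : scat (s ++ t) f = scat s (scat t f).
Proof. by rewrite /scat foldr_cat. Qed.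

Lemma origin_scat s f : origin (scat s f 0%N) = start s (origin (f 0%N)).
Proof. by case: s. Qed.

(* The integer records the degree, which tells the powers of C apart: all of  *)
(* them fix the stream C^oo.                                                  *)
Definition opV v (phi : boundary * int -> k) (x : boundary * int) : k :=
  if `[< valid x.1 >] && (origin (x.1 0%N) == v) then phi x else 0.

Definition opE e (phi : boundary * int -> k) (x : boundary * int) : k :=
  if `[< valid x.1 >] && (x.1 0%N == inl e) then phi (shift x.1, x.2 - 1) else 0.

Definition opG e (phi : boundary * int -> k) (x : boundary * int) : k :=
  if `[< valid x.1 >] && (origin (x.1 0%N) == tgt e)
  then phi (scons e x.1, x.2 + 1) else 0.

Fixpoint act (t : lterm k G) (phi : boundary * int -> k) : boundary * int -> k :=
  match t with
  | TVertex v => opV v phi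
  | TArrow e => opE e phi
  | TGhost e => opG e phi
  | TZero => fun=> 0
  | TOpp t => fun x => - act t phi x
  | TAdd t1 t2 => fun x => act t1 phi x + act t2 phi x
  | TMul t1 t2 => act t1 (act t2 phi)
  | TScale a t => fun x => a * act t phi x
  end.

Lemma actD (t : lterm k G) phi psi :
  act t (fun x => phi x + psi x) = fun x => act t phi x + act t psi x.
Proof.
elim: t phi psi => [v|e|e||t IHt|t1 IH1 t2 IH2|t1 IH1 t2 IH2|a t IHt] phi psi;
  apply/funext=> x /=.
- by rewrite /opV; case: ifP; rewrite ?addr0.
- by rewrite /opE; case: ifP; rewrite ?addr0.
- by rewrite /opG; case: ifP; rewrite ?addr0.
- by rewrite addr0.
- by rewrite IHt opprD.
- by rewrite IH1 IH2 addrACA.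
- by rewrite IH2 IH1.
- by rewrite IHt mulrDr.
Qed.

Lemma actZ (t : lterm k G) a phi : act t (fun x => a * phi x) = fun x => a * act t phi x.
Proof.
elim: t phi => [v|e|e||t IHt|t1 IH1 t2 IH2|t1 IH1 t2 IH2|b t IHt] phi;
  apply/funext=> x /=.
- by rewrite /opV; case: ifP; rewrite ?mulr0.
- by rewrite /opE; case: ifP; rewrite ?mulr0.
- by rewrite /opG; case: ifP; rewrite ?mulr0.
- by rewrite mulr0.
- by rewrite IHt mulrN.
- by rewrite IH1 IH2 mulrDr.
- by rewrite IH2 IH1.
- by rewrite IHt mulrCA.
Qed.

Lemma act_CK1 e e' phi :
  opG e (opE e' phi) = if e == e' then opV (tgt e) phi else fun=> 0.
Proof.
apply/funext=> -[f m]; rewrite /opG /opE /opV /=.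
have [fv|fv] := asboolP (valid f); last first.
  by case: (e == e') => //=; case: (asboolP (valid f)).
have [fe|fe] := eqVneq (origin (f 0%N)) (tgt e); last first.
  by case: (e == e'); rewrite //= (negPf fe) andbF.
have -> : `[< valid (scons e f) >] by apply/asboolP/valid_scons.
rewrite /= (_ : (inl e == inl e') = (e == e')) // addrK; case: eqP => //= _.
by rewrite fe eqxx; case: (asboolP (valid f)).
Qed.

(** A valid stream with origin at a vertex that is not a sink begins with exactly one arrow, and
    only the summand of that arrow is nonzero. *)
Lemma act_CK2 v phi x : ~~ is_sink v ->
  opV v phi x = \sum_(e | src e == v) opE e (opG e phi) x.
Proof.
case: x => f m vns; rewrite /opV /=.
have [fv|fv] := asboolP (valid f); last first.
  rewrite big1 // => e _; rewrite /opE /=.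
  by case: asboolP.
have := fv 0%N; case E : (f 0%N) => [e|w] /= Hf; last first.
  rewrite big1 => [|e _]; last by rewrite /opE /= E andbF.
  by case: eqP => // wv; case/negP: vns; rewrite -wv.
have Ee : opE e (opG e phi) (f, m) = phi (f, m).
  rewrite /opE /opG /= E eqxx; case: asboolP => //= _.
  rewrite -Hf eqxx; case: asboolP => [_|[]] /=; last exact: valid_shift.
  by rewrite scons_shift // subrK.
have E0 e' : e' != e -> opE e' (opG e' phi) (f, m) = 0.
  rewrite /opE /= E (_ : (inl e == inl e') = (e == e')) // eq_sym => /negPf->.
  by rewrite andbF.
have [ev|ev] := eqVneq.
  by rewrite (bigD1 e) /= ?ev // Ee big1 ?addr0 // => e' /andP[_ /E0].
by rewrite big1 // => e' /eqP ev'; apply: E0; apply: contraNneq ev => <-; apply/eqP.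
Qed.

Lemma act_sum (J : finType) (P : pred J) (F : J -> lterm k G) phi x :
  act (\big[@TAdd k G/@TZero k G]_(j | P j) F j) phi x = \sum_(j | P j) act (F j) phi x.
Proof.
by rewrite (big_morph (fun y : lterm k G => act y phi x) (id1 := 0) (op1 := +%R)).
Qed.

(** The operators satisfy every rule of the congruence, so the action descends to the algebra. *)
Lemma act_lcong (t t' : lterm k G) : lcong t t' -> forall phi, act t phi = act t' phi.
Proof.
elim=> {t t'} //=.
- by move=> x y z _ IH1 _ IH2 phi; rewrite IH1 IH2.
- by move=> x y _ IH phi; rewrite IH.
- by move=> x x' y y' _ IH1 _ IH2 phi; rewrite IH1 IH2.
- by move=> x x' y y' _ IH1 _ IH2 phi; rewrite IH1 IH2.
- by move=> a x x' _ IH phi; rewrite IH.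
- by move=> x y z phi; apply/funext=> p; rewrite addrA.
- by move=> x y phi; apply/funext=> p; rewrite addrC.
- by move=> x phi; apply/funext=> p; rewrite add0r.
- by move=> x phi; apply/funext=> p; rewrite addNr.
- by move=> a b x phi; apply/funext=> p; rewrite mulrA.
- by move=> x phi; apply/funext=> p; rewrite mul1r.
- by move=> a x y phi; apply/funext=> p; rewrite mulrDr.
- by move=> a b x phi; apply/funext=> p; rewrite mulrDl.
- by move=> x y z phi; rewrite actD.
- by move=> a x y phi; rewrite actZ.
- move=> v w phi; apply/funext=> p; case: eqVneq => [<-|vw]; rewrite /= /opV.
    by case: ifP => // ->.
  by case: andP => // -[_ /eqP->]; rewrite (negPf vw) andbF.
- move=> e phi; apply/funext=> p; rewrite /opV /opE.
  have [->|_] := eqVneq (p.1 0%N) (inl e); last by rewrite !andbF if_same.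
  by rewrite /= eqxx; case: asboolP.
- move=> e phi; apply/funext=> -[f m]; rewrite /opV /opE /=.
  case: asboolP => //= fv; case: eqP => //= fe.
  case: asboolP => [_|[]] /=; last exact: valid_shift.
  by have := fv 0%N; rewrite fe => ->; rewrite eqxx.
- move=> e phi; apply/funext=> p; rewrite /opV /opG.
  by case: ifP => // ->.
- move=> e phi; apply/funext=> -[f m]; rewrite /opV /opG /= eqxx andbT.
  case: asboolP => //= fv; case: eqP => //= fe.
  by case: asboolP => // -[]; apply/valid_scons.
- by move=> e e' phi; rewrite act_CK1; case: eqP.
- by move=> v vns phi; apply/funext=> p; rewrite act_sum act_CK2.
Qed.

Definition lact (x : leavitt k G) := act (repr x).

Lemma lactE (t : lterm k G) : lact (lclass t) = act t.
Proof. by apply/funext=> phi; apply/act_lcong/repr_lclass. Qed.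

Lemma lact_lin n (c : 'I_n -> k) (b : 'I_n -> leavitt k G) phi x :
  lact (\sum_(j < n) c j *: b j) phi x = \sum_(j < n) c j * lact (b j) phi x.
Proof.
rewrite (big_morph (fun y => lact y phi x) (id1 := 0) (op1 := +%R)).
- apply: eq_bigr => j _; elim/lclass_ind: (b j) => y.
  by rewrite -lclass_scale !lactE.
- by elim/lclass_ind=> y; elim/lclass_ind=> z; rewrite -lclass_add !lactE.
- exact: (congr1 (fun F => F phi x) (lactE (@TZero k G))).
Qed.

Lemma lactM x y phi : lact (x * y) phi = lact x (lact y phi).
Proof.
by elim/lclass_ind: x => x; elim/lclass_ind: y => y; rewrite -lclass_mul !lactE.
Qed.

Local Notation mon := (mon k).

Lemma lact_mon_nil v t phi f m : valid f -> origin (f 0%N) = v -> ends t v ->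
  lact (mon [::] v t) phi (f, m) = phi (scat t f, m + (size t)%:Z).
Proof.
move=> fv fo; rewrite /mon big_nil mul1r.
elim: t phi => [|e t IHt] phi /=.
  by rewrite big_nil mulr1 lactE /= /opV /= fo eqxx addr0; case: asboolP.
case/andP=> te tv; rewrite rev_cons -cats1 big_cat big_seq1 /= mulrA lactM IHt //.
rewrite lactE /= /opG /= origin_scat fo eq_sym te.
case: asboolP => [_|[]] /=; last by apply/valid_scat; rewrite fo.
by congr (phi (_, _)); lia.
Qed.

(** The arrows strip the prefix s from the argument and the ghosts then prepend t, each step moving
    the degree by one. *)
Lemma lact_mon s v t phi f m : valid f -> origin (f 0%N) = v ->
  ends s v -> ends t v ->
  lact (mon s v t) phi (scat s f, m)
    = phi (scat t f, m - (size s)%:Z + (size t)%:Z).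
Proof.
move=> fv fo sv tv; elim: s sv m => [|e s IHs] /=.
  by move=> _ m; rewrite subr0; apply: lact_mon_nil.
case/andP=> te sv m; rewrite -LE_mon lactM lactE /= /opE /= eqxx.
case: asboolP => [_|[]] /=; last first.
  by apply/valid_scons; rewrite valid_scat origin_scat fo (eqP te).
rewrite -[shift _]/(scat s f) IHs //; congr (phi (_, _)); lia.
Qed.

Lemma lact_mon0 s v t phi f m : valid f ->
  (forall g, f = scat s g -> origin (g 0%N) <> v) ->
  lact (mon s v t) phi (f, m) = 0.
Proof.
elim: s f m => [|e s IHs] f m fv fs.
  rewrite /mon big_nil mul1r lactM lactE /= /opV /=.
  by case: eqP => [fo|]; [case: (fs f)|rewrite andbF].
rewrite -LE_mon lactM lactE /= /opE /=; case: eqP => [f0|]; last by rewrite andbF.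
rewrite IHs ?if_same //; first exact: valid_shift.
by move=> g fg; apply: fs; rewrite /= -fg scons_shift.
Qed.

End Action.

(** * Streams running forever around a cycle *)

Section CyclicStreams.
Variables (G : digraph) (R : {pred gpath G}).
Hypothesis disj : cycles_pairwise_disjoint G.
Hypothesis reps : cycle_representatives R.
Implicit Types (u v w : vertex G) (e : arrow G) (s t r : seq (arrow G)).
Implicit Types (f g h : boundary G) (p q C D : gpath G).

(** These are the streams C^oo read from any vertex of C; the encoding mentions neither C nor a
    period. *)
Definition cyclic_stream f : Prop :=
  valid f /\ forall n, exists2 e, f n = inl e & cyclic e.

(** At each vertex there is only one cyclic arrow to follow. *)
Lemma cyclic_stream_uniq f g : cyclic_stream f -> cyclic_stream g ->
  origin (f 0%N) = origin (g 0%N) -> f = g.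
Proof.
move=> [fv fc] [gv gc] fg; apply/funext.
have step n : origin (f n) = origin (g n) -> f n = g n.
  have [e -> ce] := fc n; have [e' -> ce'] := gc n.
  by move/(cyclic_uniq disj ce ce') ->.
elim=> [|n IHn]; first exact: step.
apply: step; have := fv n; have := gv n; rewrite IHn.
by have [e -> _] := gc n => <- <-.
Qed.

Lemma cyclic_stream_scat s g : cyclic_stream g -> ends s (origin (g 0%N)) ->
  (forall e, e \in s -> cyclic e) -> cyclic_stream (scat s g).
Proof.
move=> [gv gc] sg sc; split; first exact/valid_scat.
elim: s sc {sg} => //= e s IHs sc [|n].
  by exists e => //; apply: sc; apply: mem_head.
by apply: IHs => e' e's; apply: sc; rewrite inE e's orbT.
Qed.

Lemma cyclic_stream_tail s h : cyclic_stream (scat s h) -> cyclic_stream h.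
Proof.
elim: s => //= e s IHs [fv fc]; apply: IHs; split; first exact: valid_shift fv.
by move=> n; apply: fc n.+1.
Qed.

(** Every arrow of s is cyclic, so the word can be traversed backwards by detours. *)
Lemma cyclic_stream_reach s h : cyclic_stream (scat s h) ->
  reach (origin (h 0%N)) (start s (origin (h 0%N))).
Proof.
elim: s => [_|e s IHs /= fc]; first exact: reach_refl.
have := IHs (cyclic_stream_tail (s := [:: e]) fc).
have [fv /(_ 0%N)[_ [<-] ce]] := fc.
have := fv 0%N; rewrite /= origin_scat => <- hs; exact: reach_trans ce.
Qed.

Lemma cyclic_next e : cyclic e -> exists2 e', src e' = tgt e & cyclic e'.
Proof.
move=> ce; have [s se te] := ce; case: s se te => [|e' s] se te.
  by exists e.
exists e'; first exact: te.
apply: (@closed_cyclic _ (e :: e' :: s) (src e)) => //.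
  by rewrite [ends _ _]/(_ && ends (e' :: s) (src e)) se te eqxx.
by rewrite !inE eqxx orbT.
Qed.

Lemma cyclic_stream_exists C : is_cycle C ->
  exists2 g, cyclic_stream g & origin (g 0%N) = psrc C.
Proof.
move=> Cc; have [C0 Cends Cstart _] := cycleP Cc.
have [e [ec es]] : exists e, cyclic e /\ src e = psrc C.
  case E : (parrows C) C0 => [//|e s] _; exists e; split.
    by apply: closed_cyclic Cends _ _; rewrite // E mem_head.
  by rewrite -(Cstart (psrc C)) E.
have [nx nxP] : {nx & forall e, cyclic e -> src (nx e) = tgt e /\ cyclic (nx e)}.
  apply: (@choice _ _ (fun a b : arrow G => cyclic a -> src b = tgt a /\ cyclic b)) => a.
  have [/cyclic_next[b ba cb]|na] := EM (cyclic a).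
    by exists b.
  by exists a.
have itc n : cyclic (iter n nx e) by elim: n => //= n /nxP[].
exists (fun n => inl (iter n nx e)) => //; split=> n; last by exists (iter n nx e).
by have [] := nxP _ (itc n).
Qed.

Lemma scat_compare s t f h : scat s f = scat t h ->
  (exists2 r, s = t ++ r & h = scat r f) \/ (exists2 r, t = s ++ r & f = scat r h).
Proof.
elim: s t => [|e s IHs] [|e' t] sf; first by left; exists [::].
- by right; exists (e' :: t).
- by left; exists (e :: s).
have [ee'] := congr1 (@^~ 0%N) sf; have /IHs := congr1 (@shift G) sf; rewrite -ee'.
by case=> -[r -> ->]; [left|right]; exists r.
Qed.

(** Prepending r or C fixes the cyclic stream at the base, so one of r and C is a prefix of the
    other. If r = C r2, the shorter closed word r2 is treated by induction. *)
Lemma closed_word_cycle C r : is_cycle C -> r != [::] ->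
  ends r (psrc C) -> start r (psrc C) = psrc C -> exists s, r = s ++ parrows C.
Proof.
move=> Cc; have [C0 Cends Cstart Cu] := cycleP Cc.
have [g gc go] := cyclic_stream_exists Cc.
have closed_scat s : ends s (psrc C) -> start s (psrc C) = psrc C -> scat s g = g.
  move=> sC ssC; apply: cyclic_stream_uniq => //; last by rewrite origin_scat go.
  by apply: cyclic_stream_scat; rewrite ?go // => e; apply: closed_cyclic sC ssC.
have [n] := ubnP (size r); elim: n r => // n IHn r rn r0 rC rsC.
have : scat r g = scat (parrows C) g by rewrite !closed_scat.
case/scat_compare=> -[r2 E gr2].
  have [r20|r2n0] := eqVneq r2 [::]; first by exists [::]; rewrite E r20 cats0.
  have r2s : start r2 (psrc C) = psrc C by rewrite -{1}go -origin_scat -gr2 go.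
  have [||s r2E] := IHn r2 _ r2n0 _ r2s.
  - move: rn; rewrite E size_cat ltnS; apply: leq_trans.
    by rewrite -[X in (X < _)%N]add0n ltn_add2r lt0n size_eq0.
  - by move: rC; rewrite E ends_cat => /andP[].
  by exists (parrows C ++ s); rewrite E r2E catA.
case: r2 E {gr2} => [|e r2] E; first by exists [::]; rewrite E cats0.
(* Here C = r r2 with both parts nonempty, so C would leave its base twice, against the distinctness
   of its sources. *)
case: r r0 rC rsC {rn} E => // a r _ rC rsC E.
move: Cends; rewrite E ends_cat => /andP[/ends_last ar _].
move: rC => /ends_last; rewrite ar /= => eC.
by move: Cu; rewrite E /= map_cat mem_cat /= eC -rsC inE eqxx orbT.
Qed.

(** One of p and q extends the other by a closed word at the base of C; if nonempty, it would end in
    C, which P_C forbids. *)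
Lemma in_P_scat C p q g : is_cycle C -> cyclic_stream g ->
  origin (g 0%N) = psrc C -> in_P C p -> in_P C q ->
  scat (parrows p) g = scat (parrows q) g -> p = q.
Proof.
move=> Cc gc go Pp Pq; have [tp _] := Pp; have [tq _] := Pq.
have sub p1 q1 r : in_P C p1 -> parrows p1 = parrows q1 ++ r -> g = scat r g ->
    parrows p1 = parrows q1.
  move=> /(in_P_words _ Cc)[tp1 np1] p1E gr; rewrite p1E.
  have [->|r0] := eqVneq r [::]; first by rewrite cats0.
  have rC : ends r (psrc C).
    have [+ _] := gc; rewrite gr => /valid_scat[+ _]; by rewrite go.
  have rs : start r (psrc C) = psrc C by rewrite -{1}go -origin_scat -gr go.
  have [s rE] := closed_word_cycle Cc r0 rC rs.
  by case: (np1 (parrows q1 ++ s)); rewrite p1E rE catA.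
case/scat_compare=> -[r E gr]; apply: gpath_inj; rewrite ?tp ?tq //.
  exact: sub Pp E gr.
exact/esym/(sub _ _ _ Pq E gr).
Qed.

Lemma closed_tgt_mem s v e : ends s v -> start s v = v -> e \in s ->
  tgt e \in [seq src e' | e' <- s].
Proof.
move=> sv svv /splitPr es; case: es sv svv => a b.
rewrite ends_cat start_cat /= => /and3P[_ /eqP te _] svv.
rewrite te map_cat mem_cat /=; case: b te => [|e' b] te /=; last first.
  by rewrite !inE eqxx !orbT.
by rewrite -svv; case: (a) => [|a0 a'] /=; rewrite !inE eqxx ?orbT.
Qed.

(** A path from the base of C to that of D is part of a closed path, so its arrows are cyclic and by
    [cyclic_uniq] never leave C. The cycles then meet, hence are equivalent, and representatives are
    unique. *)
Lemma same_component C D : C \in R -> D \in R ->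
  reach (psrc C) (psrc D) -> reach (psrc D) (psrc C) -> C = D.
Proof.
move=> CR DR [a aD aC] [b bC bD].
have Cc := rep_cycle reps CR; have Dc := rep_cycle reps DR.
have [C0 Cends Cstart _] := cycleP Cc; have [D0 Dends Dstart _] := cycleP Dc.
have ac e : e \in a -> cyclic e.
  move=> ea; apply: (@closed_cyclic _ (a ++ b) (psrc C)).
  - by rewrite ends_cat bD aD bC.
  - by rewrite start_cat bD.
  - by rewrite mem_cat ea.
have memD : psrc D \in cycle_vertices C.
  have : start a (psrc D) \in cycle_vertices C.
    rewrite aC /cycle_vertices -(Cstart (psrc C)); case: (parrows C) C0 => //= *.
    exact: mem_head.
  elim: a aD ac {aC} => //= e a IHa /andP[/eqP te aD] ac /mapP[e' e'C ee'].
  apply: IHa => //; first by move=> x xa; apply: ac; rewrite inE xa orbT.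
  rewrite -te (_ : e = e'); first exact: (closed_tgt_mem Cends (Cstart _) e'C).
  apply: (cyclic_uniq disj) => //; first by apply: ac; apply: mem_head.
  exact: (closed_cyclic Cends (Cstart _) e'C).
have DD : psrc D \in cycle_vertices D.
  rewrite /cycle_vertices -{1}(Dstart (psrc D)); case: (parrows D) D0 => //= *.
  exact: mem_head.
have CD : cycle_equiv C D.
  by apply: contrapT => nCD; case: (disj Cc Dc nCD (conj memD DD)).
have [_ /(_ C Cc)[E [_ Euniq]]] := reps.
rewrite -(Euniq D) // -(Euniq C) //; split=> //.
by exists 0%N; rewrite rot0.
Qed.

(** Comparing the prefixes shows that C reaches C0 in either case. The converse comes from the bound
    on [nreach] when h extends g backwards, and from the word r itself when h is a tail of g. *)
Lemma tail_at_cycle C C0 s t g h : C \in R -> C0 \in R ->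
  cyclic_stream g -> origin (g 0%N) = psrc C0 -> ends t (psrc C0) ->
  valid h -> origin (h 0%N) = psrc C -> (nreach (psrc C) <= nreach (psrc C0))%N ->
  scat t g = scat s h -> C = C0 /\ h = g.
Proof.
move=> CR C0R gc go pC0 hv ho le /scat_compare[][r E gr].
  have rC : start r (psrc C0) = psrc C by rewrite -go -origin_scat -gr.
  move: pC0; rewrite E ends_cat => /andP[_ rC0].
  have rCC0 : reach (psrc C) (psrc C0) by exists r.
  have rC0C : reach (psrc C0) (psrc C).
    by apply: contrapT => /(nreach_lt rCC0); rewrite ltnNge le.
  have CC0 := same_component CR C0R rCC0 rC0C; split=> //.
  apply: cyclic_stream_uniq; rewrite ?ho ?go ?CC0 // gr.
  apply: cyclic_stream_scat; rewrite ?go // => e; apply: closed_cyclic rC0 _.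
  by rewrite rC CC0.
have hc : cyclic_stream h by apply: (@cyclic_stream_tail r); rewrite -gr.
have rC0 : start r (psrc C) = psrc C0 by rewrite -ho -origin_scat -gr.
have rCC0 : reach (psrc C) (psrc C0).
  by rewrite -rC0 -ho; apply: cyclic_stream_reach; rewrite -gr.
have rC0C : reach (psrc C0) (psrc C).
  exists r => //; have [+ _] := gc; rewrite gr => /valid_scat[+ _].
  by rewrite ho.
have CC0 := same_component CR C0R rCC0 rC0C; split=> //.
by apply: cyclic_stream_uniq; rewrite ?ho ?go ?CC0.
Qed.

End CyclicStreams.

(** * Linear independence *)

Section Independence.
Variables (k : comPzRingType) (G : digraph) (R : {pred gpath G}).
Hypothesis disj : cycles_pairwise_disjoint G.
Hypothesis reps : cycle_representatives R.
Implicit Types (u v w : vertex G) (e : arrow G) (s t r : seq (arrow G)).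
Implicit Types (f g h : boundary G) (p q C D : gpath G) (i : basis_index G).

Lemma valid_not_sink f e n : f n = inl e -> ~~ is_sink (origin (f n)).
Proof. by move=> ->; apply/forallPn; exists e; rewrite negbK. Qed.

Lemma scat_size s h : scat s h (size s) = h 0%N.
Proof. by elim: s. Qed.

Lemma scat_arrows s g : (forall n, exists e, g n = inl e) ->
  forall n, exists e, scat s g n = inl e.
Proof. by move=> ge; elim: s => //= e s IHs [|n]; [exists e|apply: IHs]. Qed.

Lemma size_pow C n : size (pow C n) = (n * size (parrows C))%N.
Proof. by rewrite /pow size_flatten /shape map_nseq sumn_nseq mulnC. Qed.

Lemma basis_right_ends i : basis_index_valid R i ->
  ends (basis_right i) (basis_mid i).
Proof.
case: i => [p q|C p [n|n] q] /= => [[tpq _]|[_ _ [tq _]]|[CR _ [tq _]]].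
- by rewrite tpq gpath_ends.
- by rewrite -tq gpath_ends.
- have Cc := rep_cycle reps CR.
  by rewrite ends_cat pow_start // pow_ends // -tq gpath_ends.
Qed.

Lemma basis_left_ends i : basis_index_valid R i ->
  ends (basis_left i) (basis_mid i).
Proof.
case: i => [p q|C p [n|n] q] /= => [[tpq _]|[CR [tp _] _]|[_ [tp _] _]].
- by rewrite gpath_ends.
- have Cc := rep_cycle reps CR.
  by rewrite ends_cat pow_start // pow_ends // -tp gpath_ends.
- by rewrite -tp gpath_ends.
Qed.

Definition basis_deg i : int :=
  (size (basis_right i))%:Z - (size (basis_left i))%:Z.

Lemma basis_deg_cycle C p n q : basis_deg (CycleIndex C p n q)
  = (size (parrows q))%:Z - (size (parrows p))%:Z - n * (size (parrows C))%:Z.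
Proof.
rewrite /basis_deg; case: n => n /=; rewrite size_cat size_pow; first lia.
rewrite NegzE; lia.
Qed.

Lemma lact_basis i phi h m : basis_index_valid R i ->
  valid h -> origin (h 0%N) = basis_mid i ->
  lact (basis_elt k i) phi (scat (basis_left i) h, m)
    = phi (scat (basis_right i) h, m + basis_deg i).
Proof.
move=> Vi hv ho; rewrite (basis_elt_mon k (rep_cycle reps) Vi).
rewrite lact_mon ?basis_left_ends ?basis_right_ends //.
by congr (phi (_, _)); rewrite /basis_deg; lia.
Qed.

Definition delta (y : boundary G * int) (x : boundary G * int) : k :=
  if `[< x = y >] then 1 else 0.

(** The point and the delta function are chosen so that i0 carries one exactly to the other, with g
    the common tail. *)
Definition coef i i0 g : k :=
  lact (basis_elt k i) (delta (scat (basis_right i0) g, basis_deg i0))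
    (scat (basis_left i0) g, 0).

Lemma coef_diag i g : basis_index_valid R i ->
  valid g -> origin (g 0%N) = basis_mid i -> coef i i g = 1.
Proof.
move=> Vi gv go; rewrite /coef lact_basis // add0r /delta.
by case: asboolP.
Qed.

Lemma coef_neq0 i i0 g : basis_index_valid R i -> basis_index_valid R i0 ->
  valid g -> origin (g 0%N) = basis_mid i0 -> coef i i0 g <> 0 ->
  exists h, [/\ valid h, origin (h 0%N) = basis_mid i,
    scat (basis_left i0) g = scat (basis_left i) h,
    scat (basis_right i0) g = scat (basis_right i) h & basis_deg i = basis_deg i0].
Proof.
move=> Vi Vi0 gv go; rewrite /coef => nz.
have fv : valid (scat (basis_left i0) g).
  by apply/valid_scat; rewrite go basis_left_ends.
have [[h [fh ho]]|nh] := EM (exists h, scat (basis_left i0) g = scat (basis_left i) h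
    /\ origin (h 0%N) = basis_mid i); last first.
  case: nz; rewrite (basis_elt_mon k (rep_cycle reps) Vi) lact_mon0 //.
  by move=> h fh ho; apply: nh; exists h.
have hv : valid h by move: fv; rewrite fh => /valid_scat[].
move: nz; rewrite fh lact_basis // add0r /delta.
by case: asboolP => // -[fr dg] _; exists h.
Qed.

Lemma coef_cycle C0 p0 n0 q0 g i :
  let i0 := CycleIndex C0 p0 n0 q0 in
  cyclic_stream g -> origin (g 0%N) = psrc C0 ->
  basis_index_valid R i0 -> basis_index_valid R i ->
  (if i is CycleIndex C _ _ _ then (nreach (psrc C) <= nreach (psrc C0))%N else true) ->
  coef i i0 g <> 0 -> i = i0.
Proof.
move=> i0 gc go V0 Vi le nz; have [gv gi] := gc.
have [h [hv ho fl fr dg]] := coef_neq0 Vi V0 gv go nz.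
have [C0R Pp0 Pq0] := V0; have C0c := rep_cycle reps C0R.
have [C0n0 C0ends C0start _] := cycleP C0c.
(* Powers of C0 are invisible on streams, so the streams can determine only p and q. *)
have fix_pow n : scat (pow C0 n) g = g.
  apply: (cyclic_stream_uniq disj); rewrite ?origin_scat ?go ?pow_start //.
  apply: cyclic_stream_scat; rewrite ?go ?pow_ends // => e.
  by apply: closed_cyclic (pow_ends n C0c) (pow_start n C0c).
case: i Vi le nz ho fl fr dg => [p q|C p n q] Vi le _ ho fl fr dg.
  have [_ ps] := Vi; have : exists e, h 0%N = inl e.
    rewrite -(scat_size (parrows p) h) -fl; apply: scat_arrows => n.
    by have [e -> _] := gi n; exists e.
  by case=> e /valid_not_sink; rewrite ho ps.
have [CR Pp Pq] := Vi.
have [CC0 hg] := tail_at_cycle disj reps CR C0R gc go (basis_left_ends V0) hv ho le fl.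
move: fl fr; rewrite hg; subst C.
have left m p1 q1 : scat (basis_left (CycleIndex C0 p1 m q1)) g = scat (parrows p1) g.
  by case: m => m //=; rewrite scat_cat fix_pow.
have right m p1 q1 : scat (basis_right (CycleIndex C0 p1 m q1)) g = scat (parrows q1) g.
  by case: m => m //=; rewrite scat_cat fix_pow.
rewrite !left !right => fl fr.
have pE := in_P_scat disj C0c gc go Pp0 Pp fl.
have qE := in_P_scat disj C0c gc go Pq0 Pq fr.
(* The degree recovers the exponent, as C0 has positive length. *)
move: dg; rewrite /i0 !basis_deg_cycle pE qE => /addrI/oppr_inj/mulIf -> //.
by rewrite eqz_nat size_eq0.
Qed.

(** Neither tail begins with an arrow, so neither prefix can properly extend the other. *)
Lemma sink_tail s t v g h : is_sink v -> (forall n, g n = inr v) ->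
  is_sink (origin (h 0%N)) -> scat s g = scat t h -> s = t /\ h = g.
Proof.
move=> vs gE hs /scat_compare[][[|e r] E gr]; rewrite ?cats0 in E => //.
- by move: hs; rewrite gr (negPf (@valid_not_sink _ e 0 _)).
- by have := gE 0%N; rewrite gr.
Qed.

Lemma coef_sink p0 q0 p q g :
  let i := SinkIndex p q in let i0 := SinkIndex p0 q0 in
  (forall n, g n = inr (ptgt p0)) ->
  basis_index_valid R i0 -> basis_index_valid R i -> coef i i0 g <> 0 -> i = i0.
Proof.
move=> i i0 gE V0 Vi nz.
have [tpq0 ps0] := V0; have [tpq ps] := Vi.
have gv : valid g by move=> n; rewrite gE.
have go : origin (g 0%N) = ptgt p0 by rewrite gE.
have [h [hv ho fl fr _]] := coef_neq0 Vi V0 gv go nz.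
have hs : is_sink (origin (h 0%N)) by rewrite ho.
have [pE hg] := sink_tail ps0 gE hs fl; have [qE _] := sink_tail ps0 gE hs fr.
have tE : ptgt p = ptgt p0 by move: ho; rewrite hg go.
by congr SinkIndex; apply: gpath_inj => //; rewrite -tpq tE.
Qed.

Lemma basis_free n (i : 'I_n -> basis_index G) (c : 'I_n -> k) :
  (forall j, basis_index_valid R (i j)) -> injective i ->
  \sum_(j < n) c j *: basis_elt k (i j) = 0 -> forall j, c j = 0.
Proof.
move=> Vi inji sum0.
(* Evaluating the relation at the test point of [i j0] leaves only [c j0] if each other term has
   zero entry or zero coefficient. *)
have isolate j0 g : valid g -> origin (g 0%N) = basis_mid (i j0) ->
    (forall j, coef (i j) (i j0) g <> 0 -> c j <> 0 -> i j = i j0) -> c j0 = 0.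
  move=> gv go iso; pose x : boundary G * int := (scat (basis_left (i j0)) g, 0).
  pose phi := delta (scat (basis_right (i j0)) g, basis_deg (i j0)).
  have := congr1 (fun y => lact y phi x) sum0; rewrite /= lact_lin.
  rewrite (bigD1 j0) //= -/(coef (i j0) (i j0) g) coef_diag // mulr1 big1.
    by rewrite addr0 => ->; rewrite (lactE (TZero k G)).
  move=> j jj0; rewrite -/(coef (i j) (i j0) g).
  have [->|cj] := eqVneq (c j) 0; first by rewrite mul0r.
  have [->|fj] := eqVneq (coef (i j) (i j0) g) 0; first by rewrite mulr0.
  by case/eqP: jj0; apply/inji/iso; apply/eqP.
(* Cycles reaching the most vertices come first: N bounds the number of vertices that C does not
   reach. *)
have cyc N j C p m q : i j = CycleIndex C p m q ->
    (#|vertex G| - nreach (psrc C) < N)%N -> c j = 0.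
  elim: N j C p m q => // N IHN j0 C p m q ij0 hN.
  have := Vi j0; rewrite ij0 => V0; have [CR _ _] := V0.
  have [g gc go] := cyclic_stream_exists (rep_cycle reps CR).
  apply: (isolate j0 g); rewrite ?ij0 //; first by have [] := gc.
  move=> j nz cj; apply: (coef_cycle gc go V0 (Vi j) _ nz).
  case E : (i j) => [//|C1 p1 m1 q1].
  rewrite leqNgt; apply/negP => lt; case: cj; apply: (IHN _ _ _ _ _ E).
  have : (nreach (psrc C1) <= #|vertex G|)%N by apply: max_card.
  move: hN lt; rewrite /=; lia.
move=> j0; case E : (i j0) => [p0 q0|C p m q]; last exact: (cyc _ _ _ _ _ _ E (ltnSn _)).
have := Vi j0; rewrite E => V0; have [_ ps0] := V0.
(* Only sink indices remain; they are tested on the constant stream at the sink. *)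
pose g : boundary G := fun=> inr (ptgt p0).
apply: (isolate j0 g); rewrite ?E //.
move=> j nz cj; have := Vi j; case Ej : (i j) nz => [p q|C p m q] nz Vj.
  exact: coef_sink V0 Vj nz.
by case: cj; exact: (cyc _ _ _ _ _ _ Ej (ltnSn _)).
Qed.

End Independence.

Theorem theorem23 (k : comPzRingType) (G : digraph) (R : {pred gpath G}) :
  cycles_pairwise_disjoint G ->
  cycle_representatives R ->
  is_basis (basis_index_valid R) (@basis_elt G k).
Proof.
move=> disj reps; split; first exact: basis_spans.
exact: basis_free.
Qed.
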